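(* Let $G$ be a graph with no even hole and no sector wheel. Then $G$ admits a chordal cover, i.e. there exist sets $X_1, X_2 \subseteq V(G)$ with $X_1 \cup X_2 = V(G)$ such that the induced subgraphs $G[X_1]$ and $G[X_2]$ are both chordal.
   Context: All graphs are finite and simple. A hole is an induced cycle with at least four vertices; it is even if it has an even number of vertices. A graph is chordal if it contains no hole. A wheel $(H,w)$ in $G$ consists of a hole $H$ of $G$ and a vertex $w \in V(G)\setminus V(H)$ with at least three neighbors in $V(H)$. A wheel $(H,w)$ is universal if $w$ is adjacent to every vertex of $H$. A sector wheel is a wheel $(H,w)$ such that either it is universal or $N(w)\cap V(H)$ induces a path. ''$G$ has no sector wheel'' means no hole $H$ and vertex $w$ of $G$ form a sector wheel. *)

(* Defs.v *)
From HB Require Import structures.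
From mathcomp Require Import all_boot.

Set Implicit Arguments.
Unset Strict Implicit.
Unset Printing Implicit Defensive.

(* A graph with vertex set T is given by its adjacency relation e : rel T,
   assumed symmetric and irreflexive where it matters. *)

Definition graph_iso (T U : finType) (e : rel T) (e' : rel U) : Prop :=
  exists2 f : T -> U, bijective f & {mono f : x y / e x y >-> e' x y}.

Definition induced (T : finType) (e : rel T) (X : {set T}) :
    rel {x : T | x \in X} :=
  fun x y => e (val x) (val y).
Arguments induced {T} e X.

(* n is the number of vertices. *)
Definition path_graph (n : nat) : rel 'I_n :=
  fun i j => (i.+1 == j :> nat) || (j.+1 == i :> nat).
Arguments path_graph n : clear implicits.

(* A simple cycle only for n >= 3 (there is a loop for n = 1). *)
Definition cycle_graph (n : nat) : rel 'I_n :=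
  fun i j => (i.+1 %% n == j :> nat) || (j.+1 %% n == i :> nat).
Arguments cycle_graph n : clear implicits.

Definition induces_path (T : finType) (e : rel T) (X : {set T}) : Prop :=
  graph_iso (induced e X) (path_graph #|X|).

Definition induces_cycle (T : finType) (e : rel T) (X : {set T}) : Prop :=
  graph_iso (induced e X) (cycle_graph #|X|).

(* Holes are identified with their vertex sets, which determine them since
   they are induced subgraphs. *)
Definition hole (T : finType) (e : rel T) (H : {set T}) : Prop :=
  4 <= #|H| /\ induces_cycle e H.

Definition even_hole (T : finType) (e : rel T) (H : {set T}) : Prop :=
  hole e H /\ ~~ odd #|H|.

Definition chordal (T : finType) (e : rel T) : Prop :=
  forall H : {set T}, ~ hole e H.

Definition nbrs_in (T : finType) (e : rel T) (w : T) (H : {set T}) : {set T} :=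
  [set x in H | e w x].

Definition wheel (T : finType) (e : rel T) (H : {set T}) (w : T) : Prop :=
  [/\ hole e H, w \notin H & 3 <= #|nbrs_in e w H|].

Definition universal_wheel (T : finType) (e : rel T) (H : {set T}) (w : T) :
    Prop :=
  wheel e H w /\ {in H, forall x, e w x}.

Definition sector_wheel (T : finType) (e : rel T) (H : {set T}) (w : T) :
    Prop :=
  wheel e H w /\ (universal_wheel e H w \/ induces_path e (nbrs_in e w H)).

Definition chordal_cover (T : finType) (e : rel T) (X1 X2 : {set T}) : Prop :=
  [/\ X1 :|: X2 = [set: T],
      chordal (induced e X1) & chordal (induced e X2)].

(* Main.v *)
(* Split the vertices by the parity of their breadth-first level.  A hole inside
   a parity class lies in a single level, so the point is that no hole H lies in
   one level.  H is odd and every vertex of H has a neighbor in the previous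
   level F; two vertices of F are linked by an induced path through lower levels,
   whose interior has no neighbor on H.  The vertex counts of the holes made of
   an arc of H closed through a vertex of F, or through a link, are odd, so
     - consecutive neighbors of u in F on H are at odd distance, hence u has one
       neighbor on H, or two adjacent ones, or at least three ("big");
     - all vertices of F with two adjacent neighbors have the same pair;
     - a link between two big vertices has an even number of vertices, so that
       along an edge of H from a neighbor of u to a neighbor of w, one of the ends
       is a common neighbor.
   A big vertex that forms no sector wheel has a gap i < j between consecutive
   neighbors avoiding the special pair.  Take u and such a gap with j - i minimal.
   A vertex w of F adjacent to i+1 is big, hence adjacent to i; by minimality its
   neighbors in [i, j] form an initial interval, which must be {i, i+1}, as
   otherwise w and the hole u, i, ..., j form a sector wheel.  A vertex of F
   adjacent to i+2 then has to be adjacent to i+1 as well, which was excluded. *)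

Require Import Defs.
From mathcomp Require Import all_boot.
From mathcomp Require Import zify.
From Stdlib Require Import Classical_Prop.

Set Implicit Arguments.
Unset Strict Implicit.
Unset Printing Implicit Defensive.

(** * Holes and sector wheels given by vertex sequences *)

Section InducedSeq.

Variables (T : finType) (e : rel T) (x0 : T).
Hypotheses (e_sym : symmetric e) (e_irrefl : irreflexive e).

Definition ipath (s : seq T) : Prop :=
  uniq s /\ forall i j, i < size s -> j < size s ->
    e (nth x0 s i) (nth x0 s j) = (i.+1 == j) || (j.+1 == i).

Definition icycle (s : seq T) : Prop :=
  uniq s /\ forall i j, i < size s -> j < size s ->
    e (nth x0 s i) (nth x0 s j) =
    [|| i.+1 == j, j.+1 == i, (i == 0) && (j.+1 == size s)
      | (j == 0) && (i.+1 == size s)].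

(** The isomorphism sends a vertex to its index in [s]; it is injective between types of equal
    cardinality, hence bijective. *)
Lemma induced_seq_iso (s : seq T) (r : rel nat) : uniq s ->
    (forall i j, i < size s -> j < size s ->
       e (nth x0 s i) (nth x0 s j) = r i j) ->
  graph_iso (induced e [set x in s])
    (fun i j : 'I_#|[set x in s]| => r i j).
Proof.
move=> us es.
have cardS : #|[set x in s]| = size s by rewrite cardsE; apply/card_uniqP.
have ltS (x : {x : T | x \in [set x in s]}) : index (val x) s < #|[set x in s]|.
  by rewrite cardS index_mem; have := valP x; rewrite inE.
have memS (x : {x : T | x \in [set x in s]}) : val x \in s.
  by have := valP x; rewrite inE.
exists (fun x => Ordinal (ltS x)).
  apply: inj_card_bij => [x y [] exy|]; last by rewrite card_sig card_ord.
  apply: val_inj; rewrite -(nth_index x0 (memS x)) exy.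
  by rewrite nth_index ?memS.
move=> x y; rewrite /induced /= -es ?index_mem ?memS //.
by rewrite !nth_index ?memS.
Qed.

Lemma icycle_hole (s : seq T) : 4 <= size s -> icycle s ->
  hole e [set x in s].
Proof.
move=> s4 [us es].
have cardS : #|[set x in s]| = size s by rewrite cardsE; apply/card_uniqP.
split; first by rewrite cardS.
rewrite /induces_cycle.
apply: (@induced_seq_iso s (fun i j =>
  (i.+1 %% #|[set x in s]| == j) || (j.+1 %% #|[set x in s]| == i))) => //.
rewrite cardS => i j li lj; rewrite es //.
have modS k : k < size s ->
    k.+1 %% size s = if k.+1 == size s then 0 else k.+1.
  by move=> lk; case: eqP => [->|?]; [rewrite modnn | rewrite modn_small //; lia].
rewrite !modS //; do 2!case: ifP; lia.
Qed.

(** Triangles satisfy [icycle] too, and three is odd anyway; so arcs can be closed up later without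
    treating cycles of length three separately. *)
Lemma icycle_odd (s : seq T) : (forall H : {set T}, ~ even_hole e H) ->
  2 < size s -> icycle s -> odd (size s).
Proof.
move=> noeven s3 cs; apply/negPn/negP => evs.
have s4 : 4 <= size s by case: (size s) s3 evs => [|[|[|[|?]]]].
apply: (noeven [set x in s]); split; first exact: icycle_hole.
by case: cs => us _; rewrite cardsE (card_uniqP us).
Qed.

(** With the cycle rotated so that the neighbors of [w] come first, both kinds of sector wheel are
    covered: a proper prefix induces a path, and [l = size s] gives a universal wheel. *)
Lemma no_prefix_wheel (s : seq T) (w : T) (l : nat) :
    (forall (H : {set T}) (w : T), ~ sector_wheel e H w) ->
    4 <= size s -> icycle s -> w \notin s -> 3 <= l <= size s ->
  ~ (forall i, i < size s -> e w (nth x0 s i) = (i < l)).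
Proof.
move=> nosec s4 cs ws /andP[l3 ls] ew; have [us es] := cs.
have usl : uniq (take l s) by rewrite take_uniq.
have nbrE : nbrs_in e w [set x in s] = [set x in take l s].
  apply/setP => x; rewrite !inE; apply/andP/idP => [[xs ewx]|xt].
    have xl : index x s < l by rewrite -ew ?index_mem ?nth_index.
    by rewrite -(nth_index x0 xs) -(nth_take _ xl) mem_nth // size_takel.
  have xs := mem_take xt; split=> //; rewrite -(nth_index x0 xs) ew ?index_mem //.
  move: xt => /(nthP x0)[i il <-]; rewrite size_takel // in il.
  by rewrite nth_take // index_uniq //; apply: leq_trans il ls.
have wh : wheel e [set x in s] w.
  split; [exact: icycle_hole | by rewrite inE |].
  by rewrite nbrE cardsE (card_uniqP usl) size_takel.
apply: (nosec [set x in s] w); split=> //.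
have [ll|ll] := ltnP l (size s).
  right; rewrite /induces_path nbrE.
  apply: (@induced_seq_iso (take l s)
            (fun i j => (i.+1 == j) || (j.+1 == i))) => //.
  rewrite size_takel // => i j il jl; rewrite !nth_take // es; lia.
left; split=> // x; rewrite inE => xs.
by rewrite -(nth_index x0 xs) ew ?index_mem // (leq_trans _ ll) ?index_mem.
Qed.

Lemma ipath_cat_cycle (s q : seq T) :
    0 < size s -> 0 < size q -> ipath s -> ipath q ->
    (forall x, x \in s -> x \notin q) ->
    (forall i j, i < size s -> j < size q ->
       e (nth x0 s i) (nth x0 q j) =
       (i.+1 == size s) && (j == 0) || (i == 0) && (j.+1 == size q)) ->
  icycle (s ++ q).
Proof.
move=> s0 q0 [us es] [uq eq] dis esq; split.
  rewrite cat_uniq us uq andbT; apply/hasPn => x xq; apply/negP => /= xs.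
  by have := dis x xs; rewrite xq.
rewrite size_cat => i j li lj; rewrite !nth_cat.
case: ltnP => hi; case: ltnP => hj.
- rewrite es //; lia.
- rewrite esq //; lia.
- rewrite e_sym esq //; lia.
- rewrite eq //; lia.
Qed.

Lemma ipath_cons (x : T) (s : seq T) : x \notin s ->
    (forall j, j < size s -> e x (nth x0 s j) = (j == 0)) ->
  ipath s -> ipath (x :: s).
Proof.
move=> xs ex [us es]; split; first by rewrite /= xs us.
move=> [|i] [|j] //= li lj.
- by rewrite ex //; lia.
- by rewrite e_sym ex //; lia.
- by rewrite es.
Qed.

Lemma ipath_behead (x : T) (s : seq T) : ipath (x :: s) -> ipath s.
Proof.
move=> [/= /andP[_ us] es]; split=> // i j li lj.
by have := es i.+1 j.+1 li lj => /= ->.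
Qed.

(** The path is cut at its last vertex equal or adjacent to [x]; no later vertex sees [x], so [x]
    followed by the rest is induced. *)
Lemma ipath_shortcut (x y : T) (s : seq T) : ipath (y :: s) ->
    has (fun z => (x == z) || e x z) (y :: s) ->
  exists q, [/\ ipath (x :: q), last x q = last y s & {subset q <= y :: s}].
Proof.
elim: s y => [|z s IH] y pys /=.
  rewrite orbF => /orP[/eqP-> | exy]; first by exists [::].
  exists [:: y]; split=> //; apply: ipath_cons => //.
    by rewrite inE; apply/eqP => xy; rewrite xy e_irrefl in exy.
  by case.
have [hzs _|nzs] := boolP (has (fun z => (x == z) || e x z) (z :: s)).
  have [q [pq lq sq]] := IH z (ipath_behead pys) hzs.
  by exists q; split=> // t /sq ts; rewrite inE ts orbT.
have /hasPn nx := nzs; move: (nzs) => /= /negPf->; rewrite orbF.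
case/orP => [/eqP-> | exy].
  by exists (z :: s); split=> // t ts; rewrite inE ts orbT.
exists [:: y, z & s]; split=> //; apply: ipath_cons => //.
  rewrite inE negb_or; apply/andP; split.
    by apply/eqP => xy; rewrite xy e_irrefl in exy.
  by apply/negP => /nx; rewrite eqxx.
move=> [|j] //= lj; apply/negbTE.
have /nx := mem_nth x0 (lj : j < size (z :: s)).
by rewrite negb_or => /andP[].
Qed.

Lemma path_ipath (x : T) (p : seq T) : path e x p ->
  exists q, [/\ ipath (x :: q), last x q = last x p & {subset q <= x :: p}].
Proof.
elim: p x => [|y p IH] x /=.
  move=> _; exists [::]; split=> //.
  by split=> // [[|i]] [|j] //= _ _; rewrite e_irrefl.
case/andP => exy /IH[q [pq lq sq]].
have hx : has (fun z => (x == z) || e x z) (y :: q) by rewrite /= exy orbT.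
have [r [pr lr sr]] := ipath_shortcut pq hx.
exists r; split=> //; first by rewrite lr lq.
move=> t /sr; rewrite !inE => /orP[->|/sq]; rewrite ?orbT //.
by rewrite inE => ->; rewrite orbT.
Qed.

Lemma ipath_rev (s : seq T) : ipath s -> ipath (rev s).
Proof.
move=> [us es]; split; first by rewrite rev_uniq.
by rewrite size_rev => i j li lj; rewrite !nth_rev // es; lia.
Qed.

End InducedSeq.

(** * Gaps of periodic predicates *)

Section CyclicPredicates.

Lemma eqn_mod_window (n i j : nat) : i <= j -> j < i + n ->
  (i == j %[mod n]) = (i == j).
Proof.
move=> ij jn; rewrite eq_sym eqn_mod_dvd //.
apply/idP/eqP => [dn | ->]; last by rewrite subnn dvdn0.
by case: (posnP (j - i)) => ji; [lia | have := dvdn_leq ji dn; lia].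
Qed.

Lemma next_true (a : pred nat) (s t : nat) : s < t -> a t ->
  exists r, [/\ s < r, r <= t, a r & forall p, s < p -> p < r -> ~~ a p].
Proof.
move=> st at_; have ex : exists r, (s < r) && a r by exists t; rewrite st.
case: (ex_minnP ex) => r /andP[sr ar] rmin; exists r; split=> //.
  by apply: rmin; rewrite st.
by move=> p sp pr; apply/negP => ap; have := rmin p; rewrite sp ap; lia.
Qed.

(** Each gap contributes one true position, its left end, and an odd length, so count and length
    agree modulo 2. *)
Lemma count_odd_gaps (a : pred nat) (s t : nat) : s <= t -> a s -> a t ->
    (forall i j, i < j -> j <= t -> a i -> a j ->
       (forall p, i < p -> p < j -> ~~ a p) -> odd (j - i)) ->
  odd (count a (iota s (t - s))) = odd (t - s).
Proof.
move=> st + at_ gap; have [m] := ubnP (t - s).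
elim: m s st => // m IH s st ltm as_.
have [|ts] := leqP t s; first by rewrite -subn_eq0 => /eqP->.
have [r [sr rt ar nr]] := next_true ts at_.
have -> : t - s = (r - s) + (t - r) by lia.
rewrite iotaD count_cat oddD subnKC; last exact: ltnW.
rewrite IH //; last by lia.
have -> : r - s = (r - s).-1.+1 by lia.
rewrite /= as_ (_ : count a (iota _ _) = 0).
  have := gap s r sr rt as_ ar nr; rewrite oddD; lia.
apply/eqP; rewrite -leqn0 leqNgt -has_count; apply/hasPn => p.
by rewrite mem_iota => pr; apply: nr; lia.
Qed.

Lemma count_periodic (a : pred nat) (n s : nat) : (forall i, a (i + n) = a i) ->
  count a (iota s n) = count a (iota 0 n).
Proof.
move=> per; elim: s => // s <-; have [->//|n0] := posnP n.
have -> : iota s.+1 n = iota s.+1 n.-1 ++ [:: s + n].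
  by have := iotaD s.+1 n.-1 1; rewrite [_ + 1]addn1 addSnnS prednK.
have -> : iota s n = s :: iota s.+1 n.-1 by rewrite -[in LHS](prednK n0).
by rewrite count_cat /= per addn0 addnC.
Qed.

(** A true position beyond the initial run would make some two consecutive true positions lie more
    than one apart. *)
Lemma prefix_of_no_gap (a : pred nat) (i d : nat) : a i ->
    (forall x y, i <= x -> x < y -> y <= i + d -> a x -> a y ->
       (forall p, x < p -> p < y -> ~~ a p) -> y = x.+1) ->
  exists l, [/\ 0 < l, l <= d.+1 &
    forall k, k <= d -> a (i + k) = (k < l)].
Proof.
move=> ai; elim: d => [|d IH] gap.
  by exists 1; split=> // k; rewrite leqn0 => /eqP->; rewrite addn0 ai.
have [|l [l0 ld al]] := IH; first by move=> x y ix xy yd; apply: gap; lia.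
have [ad|nad] := boolP (a (i + d.+1)); last first.
  exists l; split=> //; first by lia.
  move=> k; rewrite leq_eqVlt => /orP[/eqP->|]; last exact: al.
  by rewrite (negbTE nad); lia.
have := gap (i + l.-1) (i + d.+1); rewrite ad al; last by lia.
move=> dl; exists l.+1; split=> //.
have {}dl : l = d.+1.
  have [//|nl] := eqVneq l d.+1; suff : i + d.+1 = (i + l.-1).+1 by lia.
  apply: dl => //; try lia.
  move=> p lp pd; have -> : p = i + (p - i) by lia.
  by rewrite al -?leqNgt; lia.
move=> k; rewrite leq_eqVlt => /orP[/eqP->|kd]; first by rewrite ad dl ltnS leqnn.
by rewrite al //; lia.
Qed.

End CyclicPredicates.

(* A hole presented as the n-periodic sequence of its vertices, read in cyclic
   order. *)
Definition hole_seq (T : finType) (e : rel T) (n : nat) (h : nat -> T) : Prop :=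
  [/\ 4 <= n, forall i j, (h i == h j) = (i == j %[mod n]) &
      forall i j, e (h i) (h j) =
        (i.+1 == j %[mod n]) || (j.+1 == i %[mod n])].

Lemma hole_seq_of (T : finType) (e : rel T) (H : {set T}) : hole e H ->
  exists2 h, hole_seq e #|H| h & forall i, h i \in H.
Proof.
case=> H4 [f [g fK gK] fe].
have H0 : 0 < #|H| by lia.
pose o i : 'I_#|H| := Ordinal (ltn_pmod i H0).
exists (fun i => val (g (o i))); last by move=> i; apply: valP.
split=> // i j.
  rewrite (inj_eq val_inj) (inj_eq (can_inj gK)) -(inj_eq val_inj) //=.
have -> : e (val (g (o i))) (val (g (o j))) = induced e H (g (o i)) (g (o j)).
  by [].
rewrite -fe !gK /cycle_graph /=.
by rewrite -[(i %% _).+1]addn1 -[(j %% _).+1]addn1 !modnDml !addn1.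
Qed.

Section HoleSeq.

Variables (T : finType) (e : rel T).
Hypotheses (e_sym : symmetric e) (e_irrefl : irreflexive e).
Hypothesis no_even_hole : forall H : {set T}, ~ even_hole e H.
Hypothesis no_sector_wheel : forall (H : {set T}) (w : T), ~ sector_wheel e H w.
Variables (n : nat) (h : nat -> T).
Hypothesis hS : hole_seq e n h.

Let x0 := h 0.
Let n4 : 4 <= n. Proof. by case: hS. Qed.

Lemma hole_seq_periodic i : h (i + n) = h i.
Proof. by case: hS => _ hE _; apply/eqP; rewrite hE modnDr. Qed.

Lemma hole_seq_inj i j : i <= j -> j < i + n -> (h i == h j) = (i == j).
Proof. by case: hS => _ hE _ ij jn; rewrite hE eqn_mod_window. Qed.

Lemma hole_seq_adj i j : i <= j -> j.+1 < i + n ->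
  e (h i) (h j) = (i.+1 == j).
Proof.
case: hS => _ _ hE ij jn.
rewrite hE [j.+1 == i %[mod n]]eq_sym (@eqn_mod_window n i j.+1) //; last by lia.
have [->|ij1] := eqVneq i j; last by rewrite eqn_mod_window; lia.
by rewrite eq_sym eqn_mod_window; lia.
Qed.

(** * Neighbors of an outside vertex on a hole *)

Definition nbr (w : T) : pred nat := fun i => e w (h i).

Lemma nbr_periodic w i : nbr w (i + n) = nbr w i.
Proof. by rewrite /nbr hole_seq_periodic. Qed.

(** * Arcs of the hole and the cycles closing them *)

Lemma segment_ipath i m : m < n -> ipath e x0 [seq h k | k <- iota i m].
Proof.
move=> mn; split.
  rewrite map_inj_in_uniq ?iota_uniq // => p q; rewrite !mem_iota => pi qi pq.
  have [lt|lt] := leqP p q.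
    by apply/eqP; rewrite -hole_seq_inj ?pq //; lia.
  by apply/eqP; rewrite eq_sym -hole_seq_inj ?pq //; lia.
rewrite size_map size_iota => p q lp lq.
rewrite !(nth_map 0) ?size_iota // !nth_iota //.
have [lt|lt] := leqP p q; last rewrite e_sym.
  by rewrite hole_seq_adj; lia.
by rewrite hole_seq_adj; lia.
Qed.

Lemma full_icycle i : icycle e x0 [seq h k | k <- iota i n].
Proof.
split.
  rewrite map_inj_in_uniq ?iota_uniq // => p q; rewrite !mem_iota => pi qi pq.
  have [lt|lt] := leqP p q.
    by apply/eqP; rewrite -hole_seq_inj ?pq //; lia.
  by apply/eqP; rewrite eq_sym -hole_seq_inj ?pq //; lia.
have adj p q : p <= q -> q < n -> e (h (i + p)) (h (i + q)) =
    [|| p.+1 == q, q.+1 == p, (p == 0) && (q.+1 == n) | (q == 0) && (p.+1 == n)].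
  move=> pq qn; have [lt|lt] := boolP (q.+1 < p + n).
    by rewrite hole_seq_adj; lia.
  (* Only the first and last vertex of the window remain; shifting the first by a period makes the
     two indices consecutive. *)
  have -> : q = n.-1 by lia.
  have -> : p = 0 by lia.
  rewrite -hole_seq_periodic e_sym addn0 hole_seq_adj; lia.
rewrite size_map size_iota => p q lp lq.
rewrite !(nth_map 0) ?size_iota // !nth_iota //.
have [lt|/ltnW lt] := leqP p q; first by rewrite adj.
by rewrite e_sym adj //; lia.
Qed.

Lemma hole_seq_odd : odd n.
Proof.
have := icycle_odd no_even_hole _ (full_icycle 0).
by rewrite size_map size_iota; apply; lia.
Qed.

(** The sequence [s] leads from the far end of the arc back to its start, hence the order of the two
    joining edges. *)
Lemma segment_cycle i m (s : seq T) : 0 < m -> m < n -> 0 < size s ->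
    ipath e x0 s ->
    (forall p, h p \notin s) ->
    (forall p k, i <= p -> p < i + m -> k < size s ->
       e (h p) (nth x0 s k) =
       (p.+1 == i + m) && (k == 0) || (p == i) && (k.+1 == size s)) ->
  icycle e x0 ([seq h k | k <- iota i m] ++ s).
Proof.
move=> m0 mn s0 ps hs adj.
apply: ipath_cat_cycle; rewrite ?size_map ?size_iota //.
- exact: segment_ipath.
- by move=> x /mapP[p _ ->].
move=> p k lp lk; rewrite (nth_map 0) ?size_iota // nth_iota // adj //; lia.
Qed.

Lemma segment_odd i m (s : seq T) : 0 < m -> m < n -> 0 < size s ->
    2 < m + size s -> ipath e x0 s ->
    (forall p, h p \notin s) ->
    (forall p k, i <= p -> p < i + m -> k < size s ->
       e (h p) (nth x0 s k) =
       (p.+1 == i + m) && (k == 0) || (p == i) && (k.+1 == size s)) ->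
  odd (m + size s).
Proof.
move=> m0 mn s0 ms ps hs adj.
have := icycle_odd no_even_hole _ (segment_cycle m0 mn s0 ps hs adj).
by rewrite size_cat size_map size_iota; apply.
Qed.

Definition off (w : T) := forall p, w != h p.

Lemma gap_adj u i j p : i < j -> nbr u i -> nbr u j ->
    (forall p, i < p -> p < j -> ~~ nbr u p) -> i <= p -> p <= j ->
  e u (h p) = (p == i) || (p == j).
Proof.
move=> ij ai aj no ip pj; rewrite -/(nbr u p).
have [->|pi] := eqVneq p i; first by rewrite ai.
have [->|pj'] := eqVneq p j; first by rewrite aj.
by apply/negbTE/no; lia.
Qed.

(** The arc from [i] to [j] together with [u] is an induced cycle on [j - i + 2] vertices, possibly
    a triangle. The bound on [j] keeps the arc from being the whole hole. *)
Lemma gap_odd u i j : off u -> i < j -> j + 2 <= i + n ->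
    nbr u i -> nbr u j -> (forall p, i < p -> p < j -> ~~ nbr u p) ->
  odd (j - i).
Proof.
move=> offu ij jn ai aj no.
suff : odd ((j - i).+1 + size [:: u]) by rewrite /= addn1 /= negbK.
apply: (@segment_odd i) => //=; try lia.
- by split=> // [[|?]] [|?] //=; rewrite e_irrefl.
- by move=> p; rewrite inE eq_sym offu.
move=> p [|k] // ip pj _.
by rewrite e_sym /= (gap_adj ij ai aj no) //; lia.
Qed.

(** * Links between vertices outside the hole *)

Definition linked (u w : T) (s : seq T) : Prop :=
  [/\ [/\ ipath e x0 s, 1 < size s, nth x0 s 0 = u & nth x0 s (size s).-1 = w],
      forall p, h p \notin s &
      forall k p, 0 < k -> k.+1 < size s -> ~~ e (nth x0 s k) (h p)].

Lemma linked_rev u w s : linked u w s -> linked w u (rev s).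
Proof.
case=> [[ps s1 su sw] hs no]; split; first split.
- exact: ipath_rev.
- by rewrite size_rev.
- by rewrite nth_rev ?subn1 //; apply: ltnW.
- by rewrite size_rev nth_rev prednK ?subnn ?leqnn //; apply: ltnW.
- by move=> p; rewrite mem_rev.
rewrite size_rev => k p k0 ks; rewrite nth_rev; last by lia.
by apply: no; lia.
Qed.

(** The arc from [i] to [j], with [j - i + 1] vertices, closes through the reversed link into an
    induced cycle, which has odd length. *)
Lemma linked_odd u w s i j : linked u w s -> i <= j -> j + 2 <= i + n ->
    nbr u i -> nbr w j ->
    (forall p, i < p -> p <= j -> ~~ nbr u p) ->
    (forall p, i <= p -> p < j -> ~~ nbr w p) ->
  odd (j - i) = odd (size s).
Proof.
move=> /linked_rev[[ps s1 sw su] hs no] ij jn ai bj noa nob.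
rewrite -(size_rev s).
suff : odd ((j - i).+1 + size (rev s)) by rewrite addSn /= oddD; do 2!case: odd.
apply: (@segment_odd i) => //; try lia.
move=> p k ip pj ks; rewrite e_sym.
have [->|k0] := posnP k.
  rewrite sw -/(nbr w p) (_ : _ || _ = (p == j)); last by lia.
  by have [->//|pj'] := eqVneq p j; apply/negbTE/nob; lia.
have [kl|kl] := ltnP k.+1 (size (rev s)).
  by rewrite (negbTE (no _ _ _ _)) //; lia.
have -> : k = (size (rev s)).-1 by lia.
rewrite su -/(nbr u p) (_ : _ || _ = (p == i)); last by lia.
by have [->//|pi] := eqVneq p i; apply/negbTE/noa; lia.
Qed.

(** * Vertices with one, two or many neighbors on the hole *)

Definition big (u : T) : bool := 2 < count (nbr u) (iota 0 n).

(** A longer gap would leave room for at most two neighbors in a period: the positions [i] and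
    [i + n - 1]. *)
Lemma big_gap u i j : big u -> i < j ->
  (forall p, i < p -> p < j -> ~~ nbr u p) -> j + 2 <= i + n.
Proof.
rewrite /big -(count_periodic i (nbr_periodic u)) => bu ij no.
rewrite leqNgt; apply/negP => jn; move: bu; apply/negP; rewrite -leqNgt.
have -> : n = 1 + (n - 2) + 1 by lia.
rewrite !iotaD !count_cat /= (_ : count _ (iota (i + 1) _) = 0); first by lia.
apply/eqP; rewrite -leqn0 leqNgt -has_count; apply/hasPn => p.
by rewrite mem_iota => pr; apply: no; lia.
Qed.

(** The next two neighbors [r] and [t] after [i] are compared with [i + n]. Exactly two nonadjacent
    neighbors would split the odd hole into two odd gaps. *)
Lemma nbr_type u i : off u -> nbr u i ->
  [\/ big u,
      forall p, i < p -> p < i + n -> ~~ nbr u p |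
      exists s, [/\ nbr u s, nbr u s.+1 &
                    forall p, s.+1 < p -> p < s + n -> ~~ nbr u p]].
Proof.
move=> offu ai; have ain : nbr u (i + n) by rewrite nbr_periodic.
have [|r [ir rn ar nor]] := @next_true (nbr u) i (i + n) _ ain; first by lia.
have [rE|rE] := eqVneq r (i + n); first by rewrite rE in nor; constructor 2.
have [|t [rt tn at_ not_]] := @next_true (nbr u) r (i + n) _ ain; first by lia.
have [tE|tE] := eqVneq t (i + n); last first.
  constructor 1; rewrite /big -(count_periodic i (nbr_periodic u)).
  rewrite -size_filter; apply: (@uniq_leq_size _ [:: i; r; t]).
    by rewrite /= !inE; lia.
  move=> x; rewrite !inE mem_filter mem_iota.
  by case/or3P => /eqP->; rewrite ?ai ?ar ?at_ /=; lia.
constructor 3; subst t.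
have [r1|r1] := eqVneq r i.+1.
  by exists i; rewrite -r1; split=> // p; apply: not_.
have [r2|r2] := eqVneq r.+1 (i + n).
  exists r; rewrite r2; split=> // p pr1 pr2.
  rewrite -(subnK (_ : n <= p)); last by lia.
  by rewrite nbr_periodic; apply: nor; lia.
have o1 : odd (r - i) by apply: (gap_odd offu) => //; lia.
have o2 : odd (i + n - r) by apply: (gap_odd offu) => //; lia.
have : n = (r - i) + (i + n - r) by lia.
by move/(congr1 odd); rewrite oddD o1 o2 hole_seq_odd.
Qed.

Lemma big_nbr u : big u -> exists i, nbr u i.
Proof.
move=> bu; have /hasP[i _ ai] : has (nbr u) (iota 0 n).
  by rewrite has_count; rewrite /big in bu; lia.
by exists i.
Qed.

Lemma count_nbr_odd (a : pred nat) i : (forall p, a (p + n) = a p) -> a i ->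
    (forall x y, x < y -> a x -> a y -> (forall p, x < p -> p < y -> ~~ a p) ->
       odd (y - x)) ->
  odd (count a (iota 0 n)).
Proof.
move=> per ai gap; rewrite -(count_periodic i per).
have := @count_odd_gaps a i (i + n); rewrite addKn hole_seq_odd => -> //.
- exact: leq_addr.
- by rewrite per.
- by move=> x y xy _; apply: gap.
Qed.

(* With an odd link, the neighbors of u, of w, and of either one would all be
   separated by odd gaps around the odd hole, and no vertex could be a neighbor
   of both, so that odd + odd = odd. *)
Lemma big_linked_even u w s : off u -> off w -> big u -> big w ->
  linked u w s -> ~~ odd (size s).
Proof.
move=> offu offw bu bw lk; apply/negP => os.
have lk' := linked_rev lk; have os' : odd (size (rev s)) by rewrite size_rev.
(* A common neighbor would be an arc of length 0, which an odd link makes odd. *)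
have dis p : ~~ (nbr u p && nbr w p).
  apply/andP => -[ap bp]; have := @linked_odd u w s p p lk; rewrite subnn os => L.
  by have // : odd 0 = true by apply: L => //; lia.
have [i ai] := big_nbr bu; have [j bj] := big_nbr bw.
have gu x y : x < y -> nbr u x -> nbr u y ->
    (forall p, x < p -> p < y -> ~~ nbr u p) -> odd (y - x).
  by move=> xy ax ay no; apply: (gap_odd offu) => //; apply: big_gap no.
have gw x y : x < y -> nbr w x -> nbr w y ->
    (forall p, x < p -> p < y -> ~~ nbr w p) -> odd (y - x).
  by move=> xy ax ay no; apply: (gap_odd offw) => //; apply: big_gap no.
have ou := count_nbr_odd (nbr_periodic u) ai gu.
have ow := count_nbr_odd (nbr_periodic w) bj gw.
have : odd (count (predU (nbr u) (nbr w)) (iota 0 n)).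
  apply: (@count_nbr_odd _ i) => [p||x y xy ax ay no] /=.
  - by rewrite !nbr_periodic.
  - by rewrite ai.
  have nou p : x < p -> p < y -> ~~ nbr u p.
    by move=> xp py; have := no p xp py; rewrite negb_or => /andP[].
  have now p : x < p -> p < y -> ~~ nbr w p.
    by move=> xp py; have := no p xp py; rewrite negb_or => /andP[].
  have gap := big_gap bu xy nou.
  have dx := dis x; have dy := dis y.
  (* In the two mixed cases the arc from [x] to [y] is closed through the link or its reverse. *)
  case/orP: ax => ax; case/orP: ay => ay.
  - exact: gu.
  - rewrite (linked_odd lk (ltnW xy) gap ax ay) // => p xp py.
      have [->|ne] := eqVneq p y; first by move: dy; rewrite ay andbT.
      by apply: nou; rewrite // ltn_neqAle ne py.
    have [->|ne] := eqVneq p x; first by move: dx; rewrite ax.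
    by apply: now; rewrite // ltn_neqAle eq_sym ne xp.
  - rewrite (linked_odd lk' (ltnW xy) gap ax ay) // => p xp py.
      have [->|ne] := eqVneq p y; first by move: dy; rewrite ay.
      by apply: now; rewrite // ltn_neqAle ne py.
    have [->|ne] := eqVneq p x; first by move: dx; rewrite ax andbT.
    by apply: nou; rewrite // ltn_neqAle eq_sym ne xp.
  - exact: gw.
have := count_predUI (nbr u) (nbr w) (iota 0 n).
rewrite (_ : count (predI _ _) _ = 0); last first.
  by apply/eqP; rewrite -leqn0 leqNgt -has_count; apply/hasPn => p _; exact: dis.
by rewrite addn0 => ->; rewrite oddD ou ow.
Qed.

(** Otherwise the edge from [i] to [i.+1] closes through the link, which makes the link odd, against
    [big_linked_even]. *)
Lemma big_linked_step u w s i : off u -> off w -> big u -> big w ->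
  linked u w s -> nbr u i -> nbr w i.+1 -> ~~ nbr u i.+1 -> nbr w i.
Proof.
move=> offu offw bu bw lk ai bi nai; apply/negPn/negP => nbi.
have := big_linked_even offu offw bu bw lk.
rewrite -(linked_odd lk _ _ ai bi) ?subSnn //.
- by lia.
- by move=> p ip pi; have -> : p = i.+1 by lia.
- by move=> p ip pi; have -> : p = i by lia.
Qed.

(** The two arcs between the unique neighbors have lengths [d] and [n - d], both of the parity of
    the link, while their sum [n] is odd. *)
Lemma single_linked u w s i d : linked u w s -> nbr u i ->
    (forall p, i < p -> p < i + n -> ~~ nbr u p) -> nbr w (i + d) ->
    (forall p, i + d < p -> p < i + d + n -> ~~ nbr w p) ->
  1 < d -> d + 2 <= n -> False.
Proof.
move=> lk ai noa bj nob d1 dn.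
have nbn p : i <= p -> p < i + d -> ~~ nbr w p.
  by move=> ip pj; rewrite -nbr_periodic; apply: nob; lia.
have nan p : i + d <= p -> p < i + n -> ~~ nbr u p by move=> *; apply: noa; lia.
have o1 : odd d = odd (size s).
  rewrite -(addKn i d); apply: (linked_odd lk) => //; try lia.
  by move=> p ip pd; apply: noa; lia.
have o2 : odd (n - d) = odd (size s).
  rewrite -[size s]size_rev -(subnDl i).
  apply: (linked_odd (linked_rev lk)) => //; try lia.
  - by rewrite nbr_periodic.
  - by move=> p ip pn; apply: nob; lia.
have : n = d + (n - d) by lia.
by move/(congr1 odd); rewrite hole_seq_odd oddD o1 o2 addbb.
Qed.

(* The two nonempty arcs between distinct adjacent pairs, closed through the
   link, have lengths of opposite parity. *)
Lemma pair_linked u w s i d : linked u w s -> nbr u i -> nbr u i.+1 ->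
    (forall p, i.+1 < p -> p < i + n -> ~~ nbr u p) ->
    nbr w (i + d) -> nbr w (i + d).+1 ->
    (forall p, (i + d).+1 < p -> p < i + d + n -> ~~ nbr w p) ->
  0 < d -> d < n -> False.
Proof.
move=> lk ai ai1 noa bj bj1 nob d0 dn.
(* For [d = 1] this arc is the single vertex shared by the two pairs. *)
have o1 : odd (d - 1) = odd (size s).
  have -> : d - 1 = i + d - i.+1 by lia.
  apply: (linked_odd lk) => //; try lia.
    by move=> p ip pd; apply: noa; lia.
  by move=> p ip pd; rewrite -nbr_periodic; apply: nob; lia.
have o2 : odd (n - d - 1) = odd (size s).
  have -> : n - d - 1 = i + n - (i + d).+1 by lia.
  rewrite -[size s]size_rev; apply: (linked_odd (linked_rev lk)) => //; try lia.
  - by rewrite nbr_periodic.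
  - by move=> p ip pn; apply: nob; lia.
  - by move=> p ip pn; apply: noa; lia.
have : n = (d - 1) + (n - d - 1) + 2 by lia.
by move/(congr1 odd); rewrite hole_seq_odd !oddD o1 o2 addbb.
Qed.

(** The window from [t + 1] to [t + n] is the hole cut open at the edge from [t] to [t + 1]. Without
    a long gap inside it, the neighbors of [u] would be consecutive and form a sector wheel. *)
Lemma big_long_gap u t : off u -> big u ->
  exists i j, [/\ t < i, j <= t + n, i.+1 < j, nbr u i /\ nbr u j &
                  forall p, i < p -> p < j -> ~~ nbr u p].
Proof.
move=> offu bu; apply: NNPP => none; have [i0 ai0] := big_nbr bu.
have tt : t < i0 + t.+1 * n by rewrite ltn_addl // leq_pmulr //; lia.
have ait : nbr u (i0 + t.+1 * n).
  elim: t.+1 => [|k IH]; first by rewrite addn0.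
  by rewrite mulSnr addnA nbr_periodic.
have [i [ti _ ai noi]] := next_true tt ait.
have itn : i <= t + n.
  rewrite leqNgt; apply/negP => itn.
  by have := noi (i - n); rewrite -nbr_periodic subnK ?ai; lia.
have [|l [l0 ln al]] := @prefix_of_no_gap (nbr u) i (t + n - i) ai.
  move=> x y ix xy yt ax ay no; apply/eqP; rewrite eqn_leq xy andbT leqNgt.
  by apply/negP => xy1; apply: none; exists x, y; split=> //; lia.
(* Positions beyond [t + n] repeat those between [t] and the first neighbor [i]. *)
have alln k : k < n -> nbr u (i + k) = (k < l).
  move=> kn; have [kt|kt] := leqP k (t + n - i); first exact: al.
  rewrite -(subnK (_ : n <= i + k)) ?nbr_periodic; last by lia.
  by rewrite (negbTE (noi _ _ _)); lia.
have lE : count (nbr u) (iota i n) = l.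
  have -> : n = l + (n - l) by lia.
  rewrite iotaD count_cat (_ : count _ (iota i l) = l); last first.
    rewrite -[RHS](size_iota i); apply/eqP; rewrite -all_count; apply/allP => p.
    rewrite mem_iota => /andP[ip pl]; rewrite -(subnKC ip) alln; lia.
  rewrite (_ : count _ _ = 0) ?addn0 //.
  apply/eqP; rewrite -leqn0 leqNgt -has_count; apply/hasPn => p.
  rewrite mem_iota => /andP[ip pl]; have {1}-> : p = i + (p - i) by lia.
  by rewrite alln; lia.
apply: (@no_prefix_wheel _ e x0 [seq h k | k <- iota i n] u l) => //.
- by rewrite size_map size_iota.
- exact: full_icycle.
- by apply/mapP => -[p _ up]; have := offu p; rewrite up eqxx.
- move: bu; rewrite /big -(count_periodic i (nbr_periodic u)) lE.
  by rewrite size_map size_iota; lia.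
rewrite size_map size_iota => k kn.
by rewrite (nth_map 0) ?size_iota // nth_iota // -alln.
Qed.

Definition adjacent_pair w i := [/\ nbr w i, nbr w i.+1 &
  forall p, i.+1 < p -> p < i + n -> ~~ nbr w p].

Lemma adjacent_pair_shift w i t : adjacent_pair w i ->
  exists2 d, d < n & adjacent_pair w (t + d).
Proof.
case=> ai ai1 no; have n0 : 0 < n by lia.
(* This offset makes [t + d] congruent to [i] modulo [n]. *)
exists ((i + (n - t %% n)) %% n); first exact: ltn_pmod.
set j := t + _; suff jE k : nbr w (j + k) = nbr w (i + k).
  split; [by rewrite -[j]addn0 jE addn0 | by rewrite -addn1 jE addn1 |].
  move=> p jp pn; rewrite -(subnKC (_ : j <= p)) ?jE; last by lia.
  by apply: no; lia.
congr (e w _); apply/eqP; case: hS => _ -> _; rewrite eqn_modDr /j modnDmr.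
have tn := ltn_pmod t n0; rewrite {1}(divn_eq t n).
have -> : t %/ n * n + t %% n + (i + (n - t %% n)) = t %/ n * n + n + i by lia.
by rewrite -mulSnr modnMDl.
Qed.

(** * A connected family cannot cover a hole *)

(** In the application, [F] consists of the vertices of the previous level in the component of the
    hole. *)
Variable F : pred T.
Hypothesis F_off : forall w, F w -> off w.
Hypothesis F_cover : forall i, exists2 w, F w & nbr w i.
Hypothesis F_linked : forall u w, F u -> F w -> u != w -> exists s, linked u w s.

(** One adjacent pair fixes [t]; by [pair_linked] every other one has offset 0 from it. If there is
    none, any [t] will do. *)
Lemma adjacent_pairs_eq : exists t, forall w i, F w -> adjacent_pair w i ->
  forall p, t.+1 < p -> p < t + n -> ~~ nbr w p.
Proof.
have [[u [t [Fu put]]]|none] := classic (exists u t, F u /\ adjacent_pair u t).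
  exists t => w i Fw /(adjacent_pair_shift t)[d dn pwt].
  have [->|uw] := eqVneq w u; first by case: put.
  have [d0|d0] := posnP d; first by case: pwt; rewrite d0 addn0.
  rewrite eq_sym in uw; have [s lk] := F_linked Fu Fw uw.
  case: put pwt => ? ? ? [? ? ?]; exfalso.
  by apply: (@pair_linked u w s t d).
by exists 0 => w i Fw pwi; case: none; exists w, i.
Qed.

(** * Long gaps in a window avoiding the special pair *)

Section Window.

Variable t : nat.
Hypothesis pairs_at_t : forall w i, F w -> adjacent_pair w i ->
  forall p, t.+1 < p -> p < t + n -> ~~ nbr w p.

Lemma window_type w i : F w -> nbr w i -> t.+1 < i -> i < t + n ->
  big w \/ forall p, i < p -> p < i + n -> ~~ nbr w p.
Proof.
move=> Fw ai ti itn; case: (nbr_type (F_off Fw) ai) => [|no|[s ps]].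
- by left.
- by right.
- by have := pairs_at_t Fw ps ti itn; rewrite ai.
Qed.

(** The odd hole has at least five vertices, so [t + 2] and [t + 4] both avoid the special pair. If
    neither is covered by a big vertex, their unique neighbors contradict [single_linked]. *)
Lemma exists_big : exists2 u, F u & big u.
Proof.
have n5 : 4 < n.
  rewrite ltn_neqAle n4 andbT; apply/eqP => n4'.
  by have := hole_seq_odd; rewrite -n4'.
have [u Fu au] := F_cover t.+2; have [w Fw aw] := F_cover (t.+2 + 2).
have [||bu|nu] := window_type Fu au; [by lia| by lia | by exists u|].
have [||bw|nw] := window_type Fw aw; [by lia| by lia | by exists w|].
have uw : u != w.
  apply/eqP => uw; rewrite -uw in aw.
  by have := nu (t.+2 + 2); rewrite aw; lia.
have [s lk] := F_linked Fu Fw uw.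
by exfalso; apply: (single_linked lk au nu aw nw); lia.
Qed.

(** Were [p] the only neighbor of [w], the arcs from [i] to [p] and from [p] to [j] would both have
    the parity of the link, making the gap even. *)
Lemma interior_big u w i j p : F u -> F w -> t < i -> j <= t + n ->
    odd (j - i) -> nbr u i -> nbr u j ->
    (forall q, i < q -> q < j -> ~~ nbr u q) ->
    i < p -> p < j -> nbr w p -> big w /\ u != w.
Proof.
move=> Fu Fw ti jt oij ai aj no ip pj bp.
have uw : u != w by apply/eqP => uw; have := no p ip pj; rewrite uw bp.
have tp : t.+1 < p by apply: leq_trans ip; rewrite ltnS.
have pt : p < t + n := leq_trans pj jt.
have [//|now] := window_type Fw bp tp pt.
have [s lk] := F_linked Fu Fw uw.
have pn : p + 2 <= i + n by clear -pj jt ti; lia.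
have jn : j + 2 <= p + n by clear -ip jt ti; lia.
have o1 : odd (p - i) = odd (size s).
  apply: (linked_odd lk (ltnW ip) pn ai bp) => q iq qp.
    exact: no iq (leq_ltn_trans qp pj).
  by rewrite -nbr_periodic; apply: now; clear -iq qp pn; lia.
have o2 : odd (j - p) = odd (size s).
  rewrite -[size s]size_rev.
  apply: (linked_odd (linked_rev lk) (ltnW pj) jn bp aj) => q pq qj.
    by apply: now pq _; clear -qj jn; lia.
  exact: no (leq_trans ip pq) qj.
move: oij; have -> : j - i = (p - i) + (j - p) by clear -ip pj; lia.
by rewrite oddD o1 o2 addbb.
Qed.

Lemma gap_sector_wheel u w i d l : off u -> off w -> u != w ->
    3 <= d -> d.+1 < n -> nbr u i -> nbr u (i + d) ->
    (forall p, i < p -> p < i + d -> ~~ nbr u p) ->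
    1 < l -> l <= d.+1 -> (forall k, k <= d -> nbr w (i + k) = (k < l)) ->
  l = 2.
Proof.
move=> offu offw uw d3 dn ai aj no l1 ld bl.
have adj p : i <= p -> p <= i + d -> e u (h p) = (p == i) || (p == i + d).
  by apply: gap_adj => //; lia.
have su : ipath e x0 [:: u] by split=> // [[|?]] [|?] //=; rewrite e_irrefl.
set S := [seq h k | k <- iota i d.+1].
have sizeS : size S = d.+1 by rewrite size_map size_iota.
have nthS k : k <= d -> nth x0 S k = h (i + k).
  by move=> kd; rewrite (nth_map 0) ?size_iota // nth_iota.
have wS : w \notin S by apply/mapP => -[p _ wp]; have := offw p; rewrite wp eqxx.
have cyc : icycle e x0 (S ++ [:: u]).
  apply: segment_cycle => // p; first by rewrite inE eq_sym offu.
  by case=> //= ip pd _; rewrite e_sym adj; lia.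
have cyc' : icycle e x0 ([:: u] ++ S).
  apply: ipath_cat_cycle => //; rewrite ?sizeS //.
  - exact: segment_ipath.
  - move=> x; rewrite inE => /eqP->; apply/mapP => -[p _ up].
    by have := offu p; rewrite up eqxx.
  by case=> //= k _ kd; rewrite nthS // adj; lia.
(* The hole formed by the arc and [u] is read from [u] if [w] sees [u], and with [u] last otherwise;
   either way the neighbors of [w] form a prefix. *)
clearbody S; have [ewu|newu] := boolP (e w u).
  exfalso; apply: (@no_prefix_wheel _ e x0 ([:: u] ++ S) w l.+1) => //.
  - by rewrite /= sizeS; lia.
  - by rewrite inE negb_or eq_sym uw.
  - by rewrite /= sizeS; lia.
  move=> [|k] /=; first by rewrite ewu.
  by rewrite sizeS ltnS => kd; rewrite nthS // ltnS -bl.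
apply/eqP; rewrite eqn_leq l1 andbT leqNgt; apply/negP => l2.
apply: (@no_prefix_wheel _ e x0 (S ++ [:: u]) w l) => //.
- by rewrite size_cat sizeS /=; lia.
- by rewrite mem_cat negb_or wS inE eq_sym.
- by rewrite size_cat sizeS /=; lia.
rewrite size_cat sizeS => k kd; rewrite nth_cat sizeS; case: ltnP => dk.
  by rewrite nthS // -bl.
have -> : k = d.+1 by rewrite /= in kd; lia.
by rewrite subnn /= (negbTE newu); lia.
Qed.

Lemma no_long_gap m u i j : j - i < m -> F u -> big u -> t < i -> j <= t + n ->
  i.+1 < j -> nbr u i -> nbr u j ->
  (forall p, i < p -> p < j -> ~~ nbr u p) -> False.
Proof.
elim: m u i j => // m IH u i j jim Fu bu ti jt ij ai aj no.
have offu := F_off Fu; have jn := big_gap bu (ltnW ij) no.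
have oij : odd (j - i) by apply: (gap_odd offu) => //; exact: ltnW.
have ij2 : i.+2 < j.
  by rewrite ltn_neqAle ij andbT; apply/eqP => jE; rewrite -jE -addn2 addKn in oij.
have ltj : i < j := ltnW ij.
(* This is where minimality enters: the neighbors of [w] in the gap turn out to be exactly [i] and
   [i.+1]. *)
have first w : F w -> nbr w i.+1 -> ~~ nbr w i.+2.
  move=> Fw b1; have offw := F_off Fw.
  have [bw uw] : big w /\ u != w by apply: (@interior_big u w i j i.+1).
  have [s lk] := F_linked Fu Fw uw.
  have b0 : nbr w i := big_linked_step offu offw bu bw lk ai b1 (no _ (ltnSn i) ij).
  have [|l [l0 ld bl]] := @prefix_of_no_gap (nbr w) i (j - i) b0.
    rewrite subnKC ?(ltnW ltj) // => x y ix xy yj bx by_ nob.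
    apply/eqP; rewrite eqn_leq xy andbT leqNgt; apply/negP => xy1.
    (* A long gap of [w] cannot start at [i], since it would skip the neighbor [i.+1]; so it is
       shorter than [j - i] and induction applies. *)
    have [xi|xi] := eqVneq i x.
      by subst x; have := nob i.+1 (ltnSn i) xy1; rewrite b1.
    have {}xi : i < x by rewrite ltn_neqAle xi.
    apply: (IH w x y) => //; last exact: leq_trans yj jt.
      by clear -jim ltj xi yj; lia.
    exact: ltn_trans ti xi.
  have d3 : 3 <= j - i by clear -ij2; lia.
  have l1 : 1 < l by rewrite -bl ?addn1 ?subn_gt0.
  rewrite -addn2 bl; last exact: ltnW.
  rewrite (@gap_sector_wheel u w i (j - i) l) ?ltnn ?subnKC ?(ltnW ltj) //.
  by clear -jn ltj; lia.
have [w Fw b1] := F_cover i.+1; have [v Fv c2] := F_cover i.+2.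
have nb2 := first w Fw b1.
have [bw _] : big w /\ u != w by apply: (@interior_big u w i j i.+1).
have [bv _] : big v /\ u != v by apply: (@interior_big u v i j i.+2) => //; exact: ltnW.
have wv : w != v by apply/eqP => wv; rewrite wv c2 in nb2.
have [s lk] := F_linked Fw Fv wv.
have c1 := big_linked_step (F_off Fw) (F_off Fv) bw bv lk b1 c2 nb2.
by have := first v Fv c1; rewrite c2.
Qed.

End Window.

Lemma no_linked_cover : False.
Proof.
have [t pt] := adjacent_pairs_eq; have [u Fu bu] := exists_big pt.
have [i [j [ti jt ij [ai aj] no]]] := big_long_gap t (F_off Fu) bu.
exact: (no_long_gap pt (leqnn _) Fu bu ti jt ij ai aj no).
Qed.

End HoleSeq.

(** * Breadth-first levels *)

Section Layers.

Variables (T : finType) (e : rel T).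
Hypotheses (e_sym : symmetric e) (e_irrefl : irreflexive e).

(* Breadth-first search run simultaneously from one root per component. *)
Definition ball (j : nat) : {set T} :=
  iter j (fun B => B :|: [set x | [exists y in B, e y x]])
    [set x | root e x == x].

Lemma ballS j : ball j.+1 = ball j :|: [set x | [exists y in ball j, e y x]].
Proof. by []. Qed.

Lemma ball_path x j p : x \in ball j -> path e x p ->
  last x p \in ball (j + size p).
Proof.
elim: p x j => [|y p IH] x j /= xj; first by rewrite addn0.
case/andP => exy; rewrite addnS -addSn; apply: IH.
by rewrite ballS !inE; apply/orP; right; apply/existsP; exists x; rewrite xj.
Qed.

Lemma exists_ball x : exists j, x \in ball j.
Proof.
have : connect e (root e x) x by rewrite sym_connect_sym ?connect_root.
case/connectP => p pp ->; exists (0 + size p); apply: ball_path => //.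
by rewrite inE root_root //; apply: sym_connect_sym.
Qed.

Definition level x := ex_minn (exists_ball x).

Lemma ball_level x : x \in ball (level x).
Proof. by rewrite /level; case: ex_minnP. Qed.

Lemma level_le x j : x \in ball j -> level x <= j.
Proof. by rewrite /level; case: ex_minnP => m _; apply. Qed.

Lemma level_adj x y : e x y -> level y <= (level x).+1.
Proof.
move=> exy; apply: level_le; rewrite ballS !inE; apply/orP; right.
by apply/existsP; exists x; rewrite ball_level.
Qed.

Lemma level_pred x j : level x = j.+1 -> exists2 y, e x y & level y = j.
Proof.
move=> xj; have := ball_level x; rewrite xj ballS !inE => /orP[/level_le|].
  by rewrite xj ltnn.
case/existsP => y /andP[/level_le yj eyx]; exists y; first by rewrite e_sym.
by apply/eqP; rewrite eqn_leq yj -ltnS -xj level_adj.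
Qed.

Lemma level0_root x : level x = 0 -> root e x = x.
Proof. by move=> x0; have := ball_level x; rewrite x0 inE => /eqP. Qed.

Lemma root_adj x y : e x y -> root e x = root e y.
Proof.
by move=> exy; apply/(rootP (sym_connect_sym e_sym)); apply: connect1.
Qed.

Lemma level_descent x : exists p, [/\ path e x p, last x p = root e x &
  all (fun z => level z < level x) p].
Proof.
move xj: (level x) => j; elim: j x xj => [|j IH] x xj.
  by exists [::]; rewrite /= level0_root.
have [y exy yj] := level_pred xj; have [p [pp lp ap]] := IH y yj.
exists (y :: p); split=> /=; first by rewrite exy.
  by rewrite lp (root_adj exy).
by rewrite yj ltnSn; apply: sub_all ap => z /= /ltnW.
Qed.

Lemma layer_ipath x0 u w j : u != w -> root e u = root e w ->
    level u = j -> level w = j ->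
  exists s, [/\ ipath e x0 s, 1 < size s, nth x0 s 0 = u,
      nth x0 s (size s).-1 = w &
      forall k, 0 < k -> k.+1 < size s -> level (nth x0 s k) < j].
Proof.
move=> uw ruw uj wj.
have [p [pp lp ap]] := level_descent u; have [q [pq lq aq]] := level_descent w.
(* [p] already ends at the common root, so [belast] drops the root before the way up to [w]. *)
have pr : path e u (p ++ rev (belast w q)).
  rewrite cat_path pp lp ruw -lq rev_path.
  by rewrite (eq_path (e' := e)) // => x y; rewrite e_sym.
have lr : last u (p ++ rev (belast w q)) = w.
  rewrite last_cat lp ruw -lq -[LHS]/(last w (last w q :: rev (belast w q))).
  by rewrite -rev_rcons -lastI rev_cons last_rcons.
have [r [ir lr' sr]] := path_ipath x0 e_sym e_irrefl pr.
have r0 : 0 < size r by case: r ir lr' sr => //= _ lr'; rewrite lr' lr eqxx in uw.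
have lw : nth x0 (u :: r) (size r) = w by rewrite nth_last /= lr' lr.
exists (u :: r); split=> // k k0 kr; set z := nth _ _ _.
have [ur _] := ir.
have zu : z != u.
  by rewrite -[u]/(nth x0 (u :: r) 0) (nth_uniq x0 (ltnW kr) (ltn0Sn _) ur) -lt0n.
have zw : z != w by rewrite -lw (nth_uniq x0 (ltnW kr) (ltnSn _) ur) ltn_eqF.
have : z \in u :: r := mem_nth x0 (ltnW kr); rewrite inE (negbTE zu) /=.
move/sr; rewrite inE (negbTE zu) /= mem_cat mem_rev.
case/orP => [/(allP ap)|/mem_belast]; first by rewrite uj.
by rewrite inE (negbTE zw) /= => /(allP aq); rewrite wj.
Qed.

Hypothesis no_even_hole : forall H : {set T}, ~ even_hole e H.
Hypothesis no_sector_wheel : forall (H : {set T}) (w : T), ~ sector_wheel e H w.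

(** At level 0 all vertices of the connected hole would be the same root. At level [j + 1], links
    through levels at most [j] avoid the hole, and their interior, below level [j], has no neighbor
    on it. *)
Lemma no_hole_in_layer n h j : hole_seq e n h -> (forall i, level (h i) = j) ->
  False.
Proof.
move=> hS hj; have [n4 hE hA] := hS.
have adjS i : e (h i) (h i.+1) by rewrite hA eqxx.
have rh i : root e (h i) = root e (h 0).
  by elim: i => // i <-; rewrite (root_adj (adjS i)).
case: j hj => [|j] hj.
  have : h 0 == h 1 by rewrite -(level0_root (hj 0)) -(level0_root (hj 1)) rh.
  by rewrite (hole_seq_inj hS) //; lia.
pose F w := (level w == j) && (root e w == root e (h 0)).
apply: (no_linked_cover e_sym e_irrefl no_even_hole no_sector_wheel hS (F := F)).
- move=> w /andP[/eqP wj _] p; apply/eqP => wp.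
  by have := hj p; rewrite -wp wj; lia.
- move=> i; have [y ehy yj] := level_pred (hj i).
  by exists y; rewrite /F /nbr ?yj ?eqxx -?(root_adj ehy) ?rh ?eqxx // e_sym.
move=> u w /andP[/eqP uj /eqP ru] /andP[/eqP wj /eqP rw] uw.
have [s [ps s1 su sw sl]] := layer_ipath (h 0) uw (etrans ru (esym rw)) uj wj.
exists s; split=> //.
  move=> p; apply/negP => /(nthP (h 0))[k ks kp].
  have : level (nth (h 0) s k) = j.+1 by rewrite kp.
  have [->|k0] := posnP k; first by rewrite su uj; lia.
  have [/(sl k k0)|kl] := ltnP k.+1 (size s); first by lia.
  have /eqP kE : k.+1 == size s by rewrite eqn_leq ks.
  by rewrite -kE /= in sw; rewrite sw wj; lia.
move=> k p k0 ks; apply/negP => /level_adj; rewrite hj.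
by have := sl k k0 ks; lia.
Qed.

(** Levels of adjacent vertices differ by at most one, so equal parity makes them equal all around a
    hole. *)
Lemma chordal_level_parity (X : {set T}) (b : bool) :
    (forall x, x \in X -> odd (level x) = b) ->
  chordal (induced e X).
Proof.
move=> Xb H /hole_seq_of[h [n4 hE hA] _].
have hS : hole_seq e #|H| (val \o h).
  by split=> // i j /=; rewrite ?(inj_eq val_inj) ?hE // -hA.
apply: (no_hole_in_layer (j := level (val (h 0))) hS).
elim=> // i <- /=; set x := val (h i); set y := val (h i.+1).
have exy : e x y by have := hA i i.+1; rewrite eqxx.
have xy := level_adj exy; rewrite e_sym in exy; have yx := level_adj exy.
have oxy : odd (level x) = odd (level y).
  by rewrite (Xb x (valP (h i))) (Xb y (valP (h i.+1))).
by clear -xy yx oxy; lia.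
Qed.

End Layers.

Theorem theorem1p1 (T : finType) (e : rel T)
    (e_sym : symmetric e) (e_irrefl : irreflexive e)
    (no_even_hole : forall H : {set T}, ~ even_hole e H)
    (no_sector_wheel : forall (H : {set T}) (w : T), ~ sector_wheel e H w) :
  exists X1 X2 : {set T}, chordal_cover e X1 X2.
Proof.
exists [set x | odd (level e_sym x)], [set x | ~~ odd (level e_sym x)]; split.
- by apply/setP => x; rewrite !inE orbN.
- by apply: (@chordal_level_parity _ _ e_sym _ _ _ _ true) => // x; rewrite inE.
- apply: (@chordal_level_parity _ _ e_sym _ _ _ _ false) => // x.
  by rewrite inE => /negbTE.
Qed.
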